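(* Let $\mathcal{C}$ be an irredundant covering of $\mathbb{Z}^2$ by lattices, let $N=\operatorname{lcm}(\mathcal{C})$, and let $D$ be a positive divisor of $N$ with $D\neq N$. Then $$|\{L\in\mathcal{C} : [\mathbb{Z}^2:L]\nmid D\}| \ge 1 + G(N) - G(D).$$ In particular, if $\mathcal{C}$ is not the trivial covering $\{\mathbb{Z}^2\}$, then $N>1$, and taking $D=1$ gives $|\mathcal{C}| \ge 1 + G(N)$.
   Context: A lattice is a subgroup of $\mathbb{Z}^2$ of finite index. A covering (of $\mathbb{Z}^2$) is a finite collection (set) $\mathcal{C}$ of lattices whose union is $\mathbb{Z}^2$. A covering is irredundant if no proper subset of it is a covering. The index lcm of $\mathcal{C}$ is $\operatorname{lcm}(\mathcal{C})=\operatorname{lcm}\{[\mathbb{Z}^2:L] : L\in\mathcal{C}\}$. The arithmetic function $G$ is defined, for $N=\prod_{i=1}^m p_i^{e_i}$ with distinct primes $p_i$ and $e_i\ge1$, by $G(N)=\sum_{i=1}^m (e_i(p_i-1)+1)$, with $G(1)=0$. *)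

(* Defs.v *)
From mathcomp Require Import all_boot all_order all_algebra.
From mathcomp Require Import finmap.
From mathcomp Require Import boolp classical_sets cardinality.

Set Implicit Arguments.
Unset Strict Implicit.
Unset Printing Implicit Defensive.

Import GRing.Theory.

Local Open Scope fset_scope.
Local Open Scope classical_set_scope.
Local Open Scope ring_scope.


Notation Z2 := (int * int)%type.

Definition is_subgroup (L : set Z2) : Prop := zmod_closed (mem L).

Definition cosets (L : set Z2) : set (set Z2) :=
  [set [set x + l | l in L] | x in [set: Z2]].

(* [fset_set] sends infinite sets to [fset0]: the index is 0 when infinite. *)
Definition lattice_index (L : set Z2) : nat := #|` fset_set (cosets L)|.

Definition is_lattice (L : set Z2) : Prop :=
  is_subgroup L /\ finite_set (cosets L).

Definition is_covering (C : {fset set Z2}) : Prop :=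
  (forall L, L \in C -> is_lattice L) /\
  \bigcup_(L in [set` C]) L = [set: Z2].

Definition irredundant_covering (C : {fset set Z2}) : Prop :=
  is_covering C /\ forall C' : {fset set Z2}, (C' `<` C)%fset -> ~ is_covering C'.

Definition lcm_cov (C : {fset set Z2}) : nat :=
  \big[lcmn/1%N]_(L <- C) lattice_index L.

Definition G (N : nat) : nat :=
  (\sum_(p <- primes N) (logn p N * p.-1 + 1))%N.

(* Main.v *)
(* If an irredundant covering C of Z^2 has index lcm N, every L in C contains a
   vector u that is primitive mod N, for otherwise the other members of C cover
   all primitive vectors, hence everything.  Then L = {v : n | det(u, v)} with
   n = [Z^2 : L], so L only depends on a point of P^1(Z/n).

   Write P^1(Z/N) as a box: each prime power p^e || N contributes one
   coordinate with p + 1 values (the point mod p) and e - 1 coordinates with p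
   values (the successive lifts).  A lattice of index n becomes the subcube
   obtained by fixing the first v_p(n) coordinates at every p, and
   G(N) - G(D) is the sum of (number of values - 1) over the coordinates that
   occur at N but not at D.  The bound thus follows from a statement on
   irredundant covers of a box by subcubes: if every coordinate of a nonempty
   set S is fixed by some subcube, then at least 1 + sum_(i in S) (b_i - 1) of
   the subcubes fix a coordinate of S, where b_i is the number of values of i.
   This is a multivalued form of Tarsi's lemma on minimally unsatisfiable
   formulas. *)
Require Import Defs.
From mathcomp Require Import all_boot all_order all_algebra.
From mathcomp Require Import finmap zify ring.
From mathcomp Require Import boolp.

Set Implicit Arguments.
Unset Strict Implicit.
Unset Printing Implicit Defensive.

(** * Irredundant covers of a box by subcubes *)

(* The box is prod_i [0, c i]; the subcube k fixes the coordinates in m k to the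
   values p k. *)
Section Subcubes.
Variables (I K : finType) (c : I -> nat) (m : K -> {set I}) (p : K -> I -> nat).
Implicit Types (V S : {set I}) (a x : I -> nat) (F : {set K}).

Definition in_box x := forall i, x i <= c i.

Definition in_cell k x := forall i, i \in m k -> x i = p k i.

(* The covered set is the slice of the box on which the coordinates outside V
   are frozen to those of a. *)
Definition covers V a F :=
  forall x, in_box x -> {in ~: V, x =1 a} -> exists2 k, k \in F & in_cell k x.

(** Minimality is for inclusion; [asbool] turns the proposition [covers] into the boolean predicate
    that [minset] expects. *)
Definition mincover V a F := minset (fun F' => `[< covers V a F' >]) F.

Definition meeting S F := [set k in F | m k :&: S != set0].

Let upd x i v := fun j => if j == i then v else x j.

Lemma mincoverP V a F :
  mincover V a F <->
  covers V a F /\ forall F', covers V a F' -> F' \subset F -> F' = F.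
Proof.
split=> [/minsetP[/asboolP cF mF]|[cF mF]].
  by split=> // F' cF'; apply: mF; apply/asboolP.
by apply/minsetP; split=> [|F' /asboolP]; [apply/asboolP | apply: mF].
Qed.

Lemma mincover_exists V a F :
  covers V a F -> exists2 F' : {set K}, mincover V a F' & F' \subset F.
Proof.
move=> cF; have [|F' mF' sF'] := @minset_exists _ (fun F' => `[< covers V a F' >]) F.
  exact/asboolP.
by exists F'.
Qed.

Lemma meetingP S F k :
  reflect (k \in F /\ exists2 i, i \in m k & i \in S) (k \in meeting S F).
Proof.
rewrite inE; apply: (iffP andP) => -[kF].
  by case/set0Pn=> i /setIP[im iS]; split=> //; exists i.
by case=> i im iS; split=> //; apply/set0Pn; exists i; rewrite inE im.
Qed.

(* Fix the coordinates outside S so that only subcubes meeting S are needed, and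
   extract a minimal cover F' of the slice.  If F' uses exactly S' in S, the
   members of F meeting S :\: S' are not in F', so the bounds for S' and
   S :\: S' add up. *)
Lemma mincover_proper_bound V a F S :
  (forall x F', in_box x -> mincover S x F' -> forall S', S' \subset S ->
    S' != set0 -> S' \subset \bigcup_(k in F') m k ->
    \sum_(i in S') c i < #|meeting S' F'|) ->
  mincover V a F -> S \proper V -> S != set0 ->
  S \subset \bigcup_(k in F) m k ->
  (forall S', S' \proper S -> S' != set0 -> \sum_(i in S') c i < #|meeting S' F|) ->
  \sum_(i in S) c i < #|meeting S F|.
Proof.
move=> IHV /mincoverP[cF mF] /properP[sSV _] /set0Pn[i0 i0S] Sused IHS.
(* By minimality, some point [x] of the slice lies in no member disjoint from [S]. Freezing the
   coordinates outside [S] to those of [x] excludes all these members. *)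
have /existsNP[x /not_implyP[xb /not_implyP[xa xF]]] : ~ covers V a (F :\: meeting S F).
  move=> /mF /(_ (subsetDl _ _)) eF.
  have /bigcupP[k kF im] := subsetP Sused _ i0S.
  have : k \in meeting S F by apply/meetingP; split=> //; exists i0.
  by move: kF; rewrite -{1}eF inE => /andP[/negP].
have cS : covers S x (meeting S F).
  move=> y yb yx; have [||k kF ky] := cF y => //.
    move=> i iV; have iS : i \in ~: S.
      by move: iV; rewrite !inE; apply: contra; apply/subsetP.
    by rewrite yx // xa.
  exists k => //; apply: contrapT => /negP kS; apply: xF; exists k.
    by rewrite inE kS.
  move=> i im; rewrite -yx ?ky // inE; apply: contra kS => iS.
  by apply/meetingP; split=> //; exists i.
have [F' mF' sF'] := mincover_exists cS.
pose S' := S :&: \bigcup_(k in F') m k.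
have S'S : S' \subset S by apply: subsetIl.
have F'S' k : k \in F' -> k \in meeting S' F'.
  move=> kF'; apply/meetingP; split=> //.
  have /meetingP[_ [i im iS]] := subsetP sF' _ kF'.
  by exists i => //; rewrite inE iS; apply/bigcupP; exists k.
have S'0 : S' != set0.
  have [k kF' _] : exists2 k, k \in F' & in_cell k x.
    by move/mincoverP: mF' => [cF' _]; apply: cF'.
  have /meetingP[_ [i _ iS']] := F'S' k kF'.
  by apply/set0Pn; exists i.
have lt' := IHV _ _ xb mF' S' S'S S'0 (subsetIr _ _).
have F'F : meeting S' F' \subset meeting S F.
  apply: subset_trans sF'; apply/subsetP => k /meetingP[] //.
have [SS'|SS'] := eqVneq (S :\: S') set0.
  have -> : S = S' by apply/eqP; rewrite eqEsubset S'S -setD_eq0 SS' eqxx.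
  rewrite (leq_trans lt') //.
  have -> : S' = S by apply/eqP; rewrite eqEsubset S'S -setD_eq0 SS' eqxx.
  apply: subset_leq_card; apply: subset_trans _ F'F.
  by apply/subsetP => k /meetingP[/F'S'].
have {}IHS : \sum_(i in S :\: S') c i < #|meeting (S :\: S') F|.
  apply: IHS => //; rewrite properE subsetDl /=.
  case/set0Pn: S'0 => i iS'; apply/subsetPn; exists i; first exact: (subsetP S'S).
  by rewrite inE iS'.
have dis : [disjoint meeting S' F' & meeting (S :\: S') F].
  apply/pred0P => k /=; apply/negP => /andP[/meetingP[kF' _] /meetingP[_ [i im]]].
  rewrite inE => /andP[/negP iS' iS]; apply: iS'.
  by rewrite inE iS; apply/bigcupP; exists k.
rewrite (big_setID S') /= (setIidPr S'S).
have sub : meeting S' F' :|: meeting (S :\: S') F \subset meeting S F.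
  rewrite subUset F'F /=; apply/subsetP => k /meetingP[kF [i im]].
  by rewrite inE => /andP[_ iS]; apply/meetingP; split=> //; exists i.
have := subset_leq_card sub; rewrite cardsU (disjoint_setI0 dis) cards0 subn0.
by apply: leq_trans; rewrite -addSn leq_add // ltnW.
Qed.

(* Slice V by the values of one coordinate i and take a minimal cover of each
   slice.  The cover of the t-th slice contributes at least one subcube that
   does not occur before, and more if it uses coordinates unused so far. *)
Lemma mincover_full_bound V a F :
  in_box a ->
  (forall i x F', in_box x -> i \in V -> mincover (V :\ i) x F' ->
    forall S', S' \subset V :\ i ->
    S' != set0 -> S' \subset \bigcup_(k in F') m k ->
    \sum_(j in S') c j < #|meeting S' F'|) ->
  mincover V a F -> V != set0 ->
  V \subset \bigcup_(k in F) m k ->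
  \sum_(i in V) c i < #|meeting V F|.
Proof.
move=> ab IH /mincoverP[cF mF] /set0Pn[i iV] Vused.
pose Fc v := [set k in F | (i \in m k) ==> (p k i == v)].
have updb x v : in_box x -> v <= c i -> in_box (upd x i v).
  by move=> xb vc j; rewrite /upd; case: eqP => [->|].
have Fc_covers v : v <= c i -> covers (V :\ i) (upd a i v) (Fc v).
  move=> vc x xb xa; have [||k kF kx] := cF x => //.
    move=> j; rewrite inE => jV; rewrite xa ?inE ?negb_and ?jV ?orbT // /upd.
    by case: eqP => // ji; rewrite -ji (negPf jV) in iV.
  exists k => //; rewrite inE kF; apply/implyP => im.
  by rewrite -kx // xa ?inE ?eqxx // /upd eqxx.
have /choice[Fa FaP] : forall v, exists F', v <= c i ->
    mincover (V :\ i) (upd a i v) F' /\ F' \subset Fc v.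
  move=> v; case: (leqP v (c i)) => [/Fc_covers/mincover_exists[F' ? ?]|_].
    by exists F'.
  by exists set0.
pose U t := \bigcup_(v < t) Fa v.
pose W t := (V :\ i) :&: \bigcup_(k in U t) m k.
have US t : U t.+1 = U t :|: Fa t by rewrite /U big_ord_recr.
have FaF v : v <= c i -> Fa v \subset F.
  case/FaP=> _ /subset_trans; apply; apply/subsetP => k; rewrite inE.
  by case/andP.
have FaS v k : v <= c i -> k \in Fa v -> i \in m k -> p k i = v.
  by case/FaP=> _ /subsetP s /s; rewrite inE => /andP[_ /implyP h] /h /eqP.
have UF t : t <= (c i).+1 -> U t \subset F.
  move=> tc; apply/bigcupsP => v _; apply: FaF.
  by rewrite -ltnS (leq_trans (ltn_ord v)).
(* Each new slice has to pay for the coordinates it is the first to use, plus one. The set [E] below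
   consists of members that pay for it. *)
have claim t : t <= (c i).+1 -> t + \sum_(j in W t) c j <= #|meeting V (U t)|.
  elim: t => [_|t IHt tc].
    rewrite big_pred0 // => j; rewrite !inE; apply/negP => /andP[_ /bigcupP[k]].
    by rewrite /U big_ord0 inE.
  have {}IHt := IHt (ltnW tc); have [minFa _] := FaP t tc.
  have [Fac minFa'] := (mincoverP _ _ _).1 minFa.
  suff [E [sE dE ltE]] : exists E : {set K}, [/\ E \subset meeting V (Fa t),
      [disjoint E & U t] & \sum_(j in W t.+1 :\: W t) c j < #|E|].
    have sub : meeting V (U t) :|: E \subset meeting V (U t.+1).
      rewrite US; apply/subsetP => k; rewrite inE => /orP[/meetingP[kU ex]|].
        by apply/meetingP; rewrite inE kU.
      by move=> /(subsetP sE)/meetingP[kU ex]; apply/meetingP; rewrite inE kU orbT.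
    have dis : meeting V (U t) :&: E = set0.
      apply/eqP; rewrite setI_eq0 disjoint_sym; apply: disjointWr dE.
      by apply/subsetP => k /meetingP[].
    have WS : W t \subset W t.+1.
      apply: setIS; apply/bigcupsP => k kU; apply: bigcup_sup.
      by rewrite US inE kU.
    have := subset_leq_card sub; rewrite cardsU dis cards0.
    rewrite (big_setID (W t)) /= (setIidPr WS) subn0; apply: leq_trans.
    by rewrite addSn addnA -addnS leq_add.
  have [A0|A0] := eqVneq (W t.+1 :\: W t) set0.
    (* If no member of [Fa t] fixed [i], then [Fa t] would cover all the slices, hence equal [F] by
       minimality; but [F] uses [i]. A member that fixes [i] to [t] is new, since earlier slices
       only allow smaller values. *)
    have [k kFa im] : exists2 k, k \in Fa t & i \in m k.
      apply: contrapT => no.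
      have eF : Fa t = F.
        apply: mF; last exact: FaF.
        move=> x xb xa; have [||k kFa kx] := Fac (upd x i t); first exact: updb.
          move=> j; rewrite !inE negb_and negbK /upd => /orP[->|jV] //.
          by case: eqP => // _; rewrite xa // inE.
        exists k => // j jm; rewrite -kx // /upd; case: eqP => // ji.
        by case: no; exists k; rewrite // -ji.
      have /bigcupP[k kF im] := subsetP Vused _ iV.
      by case: no; exists k; rewrite ?eF.
    exists [set k]; split.
    - by rewrite sub1set; apply/meetingP; split=> //; exists i.
    - rewrite disjoints1; apply/bigcupP => -[v _ kFv].
      have vt := ltn_ord v; have vc := leq_trans (ltnW vt) (tc : t <= c i).
      by move: vt; rewrite -(FaS _ _ vc kFv im) (FaS t) ?ltnn.
    - by rewrite A0 big_set0 cards1.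
  (* No member of [U t] fixes a coordinate in this difference, so these members are new; the
     induction hypothesis counts them. *)
  exists (meeting (W t.+1 :\: W t) (Fa t)); split.
  - apply/subsetP => k /meetingP[kFa [j jm /setDP[/setIP[/setDP[jV _] _] _]]].
    by apply/meetingP; split=> //; exists j.
  - apply/pred0P => k /=; apply/negP => /andP[/meetingP[_ [j jm]]].
    move=> /setDP[/setIP[jV _]]; rewrite inE jV /= => /negP njW kU.
    by apply: njW; apply/bigcupP; exists k.
  - apply: (IH i _ _ _ iV minFa) => //; first exact: updb.
      by apply: subset_trans (subsetDl _ _) (subsetIl _ _).
    apply/subsetP => j /setDP[/setIP[jV /bigcupP[k]]].
    rewrite US inE inE jV /= => /orP[kU jm /negP[]|kFa jm _].
      by apply/bigcupP; exists k.
    by apply/bigcupP; exists k.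
have UE : U (c i).+1 = F.
  apply: mF; last exact: UF.
  move=> x xb xa; have xc := xb i; have [/mincoverP[cFa _] _] := FaP _ xc.
  have [||k kFa kx] := cFa x => //.
    move=> j; rewrite !inE negb_and negbK /upd => /orP[/eqP->|jV]; first by rewrite eqxx.
    by case: eqP => [->//|_]; rewrite xa // inE.
  by exists k => //; apply/bigcupP; exists (Ordinal (xc : x i < (c i).+1)).
(* The value [(c i).+1] of [t] accounts both for the term [c i] and for the strict inequality. *)
have := claim _ (leqnn _); rewrite /W UE.
have -> : (V :\ i) :&: \bigcup_(k in F) m k = V :\ i.
  by apply/setIidPl; apply: subset_trans Vused; apply: subsetDl.
by rewrite (big_setD1 i iV) /= addSn.
Qed.

(** Nested induction, on the size of [V] and then of [S]: the slicing argument treats [S = V], the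
    restriction argument a proper [S]. *)
Theorem mincover_bound V a F S :
  in_box a -> mincover V a F -> S \subset V -> S != set0 ->
  S \subset \bigcup_(k in F) m k ->
  \sum_(i in S) c i < #|meeting S F|.
Proof.
have [n] := ubnP #|V|; elim: n V a F S => // n IHn V a F S.
rewrite ltnS => leVn ab mF.
have [l] := ubnP #|S|; elim: l S => // l IHl S.
rewrite ltnS => leSl sSV S0 Sused.
have [eSV|SV] := eqVneq S V.
  rewrite eSV in S0 Sused *; apply: (mincover_full_bound ab) mF S0 Sused => //.
  move=> i x F' xb iV mF' S' *; apply: IHn mF' _ _ _ => //.
  by apply: leq_trans leVn; rewrite [ltnRHS](cardsD1 i) iV.
have pSV : S \proper V by rewrite properEneq SV.
apply: (mincover_proper_bound _ mF pSV S0 Sused) => [x F' xb mF' S' *|S' pS S'0].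
  apply: IHn mF' _ _ _ => //.
  exact: leq_trans (proper_card pSV) leVn.
have sS := proper_sub pS; apply: IHl => //; last 2 first.
- exact: subset_trans sS sSV.
- exact: subset_trans sS Sused.
exact: leq_trans (proper_card pS) leSl.
Qed.

End Subcubes.

From mathcomp Require Import classical_sets cardinality.

Import GRing.Theory.

Local Open Scope fset_scope.
Local Open Scope classical_set_scope.
Local Open Scope ring_scope.

(** * Subgroups of finite index *)

Definition det (u v : Z2) : int := u.1 * v.2 - u.2 * v.1.

Definition primitive_mod (N : nat) (v : Z2) : bool := coprimez (gcdz v.1 v.2) N.

Lemma pair_mulrz (v : Z2) z : v *~ z = (z * v.1, z * v.2).
Proof.
rewrite [LHS]surjective_pairing; congr (_, _).
  by rewrite -[(v *~ z).1]/(fst (v *~ z)) raddfMz mulrzz mulrC.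
by rewrite -[(v *~ z).2]/(snd (v *~ z)) raddfMz mulrzz mulrC.
Qed.

Section Subgroup.
Variables (L : set Z2) (subL : is_subgroup L).

Lemma subgroup0 : L 0.
Proof. by case: subL => + _; rewrite inE. Qed.

Lemma subgroupB x y : L x -> L y -> L (x - y).
Proof. by case: subL => _ h Lx Ly; have := h x y; rewrite !inE; apply. Qed.

Lemma subgroupN x : L x -> L (- x).
Proof. by move=> Lx; rewrite -sub0r; apply: subgroupB => //; apply: subgroup0. Qed.

Lemma subgroupD x y : L x -> L y -> L (x + y).
Proof. by move=> Lx Ly; rewrite -[y]opprK; apply/subgroupB/subgroupN. Qed.

Lemma subgroupMn x n : L x -> L (x *+ n).
Proof.
move=> Lx; elim: n => [|n IHn]; first exact: subgroup0.
by rewrite mulrS; apply: subgroupD.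
Qed.

Lemma subgroupMz x (z : int) : L x -> L (x *~ z).
Proof.
case: z => n Lx; first exact: subgroupMn.
by rewrite NegzE mulrNz; apply/subgroupN/subgroupMn.
Qed.

Lemma subgroup_sum (T : finType) (f : T -> Z2) :
  (forall i, L (f i)) -> L (\sum_i f i).
Proof.
by move=> Lf; elim/big_ind: _ => // [|x y]; [apply: subgroup0|apply: subgroupD].
Qed.

Lemma subgroupBr x y : L (x - y) -> L y -> L x.
Proof. by move=> Lxy Ly; rewrite -(subrK y x); apply: subgroupD. Qed.

Lemma eq_coset x y :
  ([set x + l | l in L] = [set y + l | l in L]) <-> L (x - y).
Proof.
split=> [e|Lxy].
  have : [set x + l | l in L] x by exists 0; [apply: subgroup0|rewrite addr0].
  by rewrite e => -[l Ll <-]; rewrite addrAC subrr add0r.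
apply/seteqP; split=> _ [l Ll <-] /=.
  by exists (x - y + l); [apply: subgroupD|ring].
exists (- (x - y) + l); first by apply: subgroupD => //; apply: subgroupN.
by ring.
Qed.

Hypothesis finL : finite_set (cosets L).

Let Q : finType := fset_set (cosets L).

Lemma coset_in_cosets x : [set x + l | l in L] \in fset_set (cosets L).
Proof. by rewrite in_fset_set // inE; exists x. Qed.

Let q x : Q := [` coset_in_cosets x].

Let qP x y : q x = q y <-> L (x - y).
Proof.
split=> [e|/eq_coset e]; last by apply/val_inj.
by apply/eq_coset; have := congr1 val e.
Qed.

Let r (A : Q) : Z2 := xget 0 (val A).

Let rK A : q (r A) = A.
Proof.
apply/val_inj => /=; have := valP A; rewrite /r in_fset_set // inE => -[x _ eA].
rewrite -[RHS]eA -eA; apply/eq_coset; case: xgetP => [y _ [l Ll <-]|]; first by rewrite addrAC subrr add0r.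
by move=> /(_ x) []; exists 0; [apply: subgroup0|rewrite addr0].
Qed.

Lemma lattice_index_card : lattice_index L = #|Q|.
Proof. by rewrite /lattice_index cardfE. Qed.

Lemma lattice_index_gt0 : (0 < lattice_index L)%N.
Proof. by rewrite lattice_index_card; apply/card_gt0P; exists (q 0). Qed.

(* Translation by x permutes the cosets, so comparing the sums of all coset
   representatives before and after the translation gives n x = 0 mod L. *)
Lemma lattice_index_mul x : L (x *+ lattice_index L).
Proof.
have inj : injective (fun A : Q => q (r A + x)).
  move=> A B /qP; rewrite opprD addrACA subrr addr0 => /qP.
  by rewrite !rK.
have Lsum : L (\sum_A (r A + x - r (q (r A + x)))).
  by apply: subgroup_sum => A; apply/qP; rewrite rK.
have e : \sum_A r A = \sum_A r (q (r A + x)) by apply: (reindex_inj inj).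
move: Lsum; rewrite sumrB big_split /= sumr_const -lattice_index_card -e.
by rewrite addrAC subrr add0r.
Qed.

(** Every class is an integer multiple of that of [w], and the multiplier can be reduced modulo [m],
    so at most [m] classes exist. *)
Lemma lattice_index_min w m : (0 < m)%N -> L (w *+ m) ->
  (forall v, exists z : int, L (v - w *~ z)) -> (lattice_index L <= m)%N.
Proof.
move=> m0 Lm span; rewrite lattice_index_card.
have sur (A : Q) : A \in codom (fun k : 'I_m => q (w *+ k)).
  have [z Lz] := span (r A).
  have lt : (`|(z %% m)%Z| < m)%N by lia.
  apply/codomP; exists (Ordinal lt); rewrite -[LHS]rK; apply/qP => /=.
  have -> : w *+ `|(z %% m)%Z| = w *~ z - w *+ m *~ (z %/ m)%Z.
    rewrite -[w *+ m]/(w *~ m) -[w *+ _]/(w *~ (`|(z %% m)%Z|%N : int)).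
    by rewrite -mulrzA -mulrzBr; congr (w *~ _); lia.
  by rewrite opprB addrA addrAC; apply: subgroupD => //; apply: subgroupMz.
rewrite -[X in (_ <= X)%N](card_ord m).
have := leq_image_card (fun k : 'I_m => q (w *+ k)) predT.
by congr (_ <= _)%N; apply: eq_card => A; rewrite sur.
Qed.

Lemma lattice_index_mulz v z : (lattice_index L %| z)%Z -> L (v *~ z).
Proof.
by case/dvdzP => c ->; rewrite mulrC mulrzA; apply/subgroupMz/lattice_index_mul.
Qed.

(* If w completes u to a basis of Z^2 modulo n, then Z^2/L is cyclic of order
   n = [Z^2 : L], generated by the class of w, and v = det(u, v) w there. *)
Theorem lattice_detP u v : L u -> primitive_mod (lattice_index L) u ->
  L v <-> (lattice_index L %| det u v)%Z.
Proof.
set n := lattice_index L => Lu /coprimezP[[c d] /= e].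
have [s [t est]] : exists s t, s * u.1 + t * u.2 = c * gcdz u.1 u.2.
  have [s [t /= <-]] := Bezoutz u.1 u.2.
  by exists (c * s), (c * t); rewrite mulrDr !mulrA.
(* With this choice [det u w = s * u.1 + t * u.2], which is 1 modulo [n]. *)
pose w : Z2 := (- t, s).
have wP v' : L (v' - w *~ det u v').
  (* This is the identity [det u w * v' = det u v' * w + det v' w * u], with [det u w] replaced by
     [1 - d * n]. *)
  have -> : v' - w *~ det u v' = v' *~ (d * n) + u *~ det v' w.
    rewrite !pair_mulrz /det /w /= [v' in LHS]surjective_pairing.
    have := e; rewrite -est => {}e.
    congr (_, _) => /=.
      transitivity ((s * u.1 + t * u.2 + d * n) * v'.1 - (u.1 * v'.2 - u.2 * v'.1) * (-t)).
        by rewrite e mul1r.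
      by ring.
    transitivity ((s * u.1 + t * u.2 + d * n) * v'.2 - (u.1 * v'.2 - u.2 * v'.1) * s).
      by rewrite e mul1r.
    by ring.
  apply: subgroupD; last exact: subgroupMz.
  by apply: lattice_index_mulz; apply: dvdz_mull.
(* The order [m] of the class of [w] is at least [n], so a remainder modulo [n] that sends [w] into
   [L] must be zero. *)
have Lw : exists m : nat, (0 < m)%N && `[< L (w *+ m) >].
  by exists n; rewrite lattice_index_gt0; apply/asboolP/lattice_index_mul.
case: (ex_minnP Lw) => m /andP[m0 /asboolP Lm] minm.
have nm : (n <= m)%N by apply: (lattice_index_min m0 Lm) => v'; exists (det u v').
split=> [Lv|nv]; last by apply: subgroupBr (wP v) _; apply: lattice_index_mulz.
have Lz : L (w *~ det u v).
  by rewrite -[_ *~ _](subKr v); apply: subgroupB.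
have Lr : L (w *+ `|(det u v %% n)%Z|).
  rewrite -[w *+ _]/(w *~ (`|(det u v %% n)%Z|%N : int)).
  have -> : `|(det u v %% n)%Z|%N = det u v - (det u v %/ n)%Z * n :> int.
    have := lattice_index_gt0; rewrite -/n; lia.
  rewrite mulrzBr; apply: subgroupB => //.
  by apply: lattice_index_mulz; apply: dvdz_mull.
have := lattice_index_gt0; rewrite -/n => n0.
apply/dvdz_mod0P; case: (eqVneq (det u v %% n)%Z 0) => // r0.
have : (m <= `|(det u v %% n)%Z|)%N.
  by apply: minm; apply/andP; split; [lia|apply/asboolP].
lia.
Qed.

End Subgroup.

(** * Coordinates on the projective line over Z/N *)

(** Reducing the digits modulo [p] makes the extra value [p] of the first coordinate count as the
    digit 0. *)
Definition from_digits (p f : nat) (a : nat -> nat) : nat :=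
  (\sum_(j < f) (a j %% p) * p ^ j)%N.

Lemma from_digitsS p f a :
  from_digits p f.+1 a = (from_digits p f a + (a f %% p) * p ^ f)%N.
Proof. exact: big_ord_recr. Qed.

Lemma from_digits_lt p f a : (0 < p)%N -> (from_digits p f a < p ^ f)%N.
Proof.
move=> p0; elim: f => [|f IHf]; first by rewrite /from_digits big_ord0.
rewrite from_digitsS expnS; have := ltn_pmod (a f) p0.
by move: IHf; nia.
Qed.

Lemma from_digits_mod p e f a : (0 < p)%N -> (f <= e)%N ->
  (from_digits p e a %% p ^ f)%N = from_digits p f a.
Proof.
move=> p0; elim: e => [|e IHe] fe.
  by move: fe; rewrite leqn0 => /eqP ->; rewrite modn_small // from_digits_lt.
case: (ltngtP f e.+1) fe => // [fe _|-> _]; last by rewrite modn_small ?from_digits_lt.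
rewrite from_digitsS -[e in (p ^ e)%N](subnK (fe : (f <= e)%N)) expnD mulnA addnC.
by rewrite modnMDl IHe.
Qed.

Lemma eq_from_digits p f a b : (0 < p)%N ->
  from_digits p f a = from_digits p f b <->
  forall j, (j < f)%N -> a j = b j %[mod p].
Proof.
move=> p0; split=> [e j jf|eab]; last first.
  by apply: eq_bigr => j _; rewrite eab.
have pj : (0 < p ^ j)%N by rewrite expn_gt0 p0.
have digit c : (from_digits p f c %% p ^ j.+1 %/ p ^ j)%N = (c j %% p)%N.
  rewrite from_digits_mod // from_digitsS addnC divnMDl //.
  by rewrite divn_small ?addn0 // from_digits_lt.
by rewrite -!digit e.
Qed.

Lemma from_digitsK p e r : (0 < p)%N ->
  from_digits p e (fun j => r %/ p ^ j)%N = (r %% p ^ e)%N.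
Proof.
move=> p0; elim: e => [|e IHe]; first by rewrite /from_digits big_ord0 modn1.
have pe : (0 < p ^ e)%N by rewrite expn_gt0 p0.
rewrite from_digitsS IHe [in RHS](divn_eq r (p ^ e)).
rewrite [X in (X * _ + _)%N](divn_eq _ p) mulnDl -mulnA -expnS -addnA modnMDl.
rewrite [RHS]modn_small; first by rewrite addnC.
rewrite expnS; have := ltn_pmod r pe; have := ltn_pmod (r %/ p ^ e) p0; nia.
Qed.

(* A point of P^1(Z/p^e) has p + 1 residues mod p, and p lifts at each further
   level.  The first coordinate p encodes the residue (0 : 1). *)
Definition proj_point (p e : nat) (a : nat -> nat) : nat * nat :=
  if a 0%N == p then (from_digits p e a, 1%N) else (1%N, from_digits p e a).

Definition zpair (v : nat * nat) : Z2 := (v.1%:Z, v.2%:Z).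

Definition coord_max (p j : nat) : nat := (p.-1 + (j == 0))%N.

Lemma dvdz_natB (d m n : nat) : (d %| m%:Z - n%:Z)%Z = (m == n %[mod d]).
Proof. by rewrite -eqz_mod_dvd !modz_nat. Qed.

(** In a common chart the determinant is, up to sign, the difference of the two numbers. Across
    charts it is, up to sign, 1 minus a multiple of [p], a unit, so only [f = 0] is possible. *)
Lemma dvdz_det_proj_point p e f a b : prime p -> (f <= e)%N ->
  (forall j, (a j <= coord_max p j)%N) -> (forall j, (b j <= coord_max p j)%N) ->
  ((p ^ f)%N %| det (zpair (proj_point p e a)) (zpair (proj_point p e b)))%Z <->
  forall j, (j < f)%N -> a j = b j.
Proof.
move=> pp fe amax bmax; have p0 := prime_gt0 pp.
have eqab c d : (forall j, (c j <= coord_max p j)%N) -> (forall j, (d j <= coord_max p j)%N) ->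
    (c 0%N == p) = (d 0%N == p) ->
    (from_digits p e c == from_digits p e d %[mod p ^ f])%N <->
     (forall j, (j < f)%N -> c j = d j).
  move=> cmax dmax e0; rewrite !from_digits_mod //.
  have digE := eq_from_digits f c d p0.
  split=> [/eqP/digE h [|j]|h]; last first.
  - by apply/eqP/digE => j jf; rewrite h.
  - move/h; have := cmax j.+1; have := dmax j.+1; rewrite /coord_max /= => dm cm.
    by rewrite !modn_small //; lia.
  - move/h; have := cmax 0%N; have := dmax 0%N; rewrite /coord_max /=.
    move: e0; case: eqVneq => [->|c0] /esym; first by move/eqP->.
    by move/eqP=> d0 dm cm; rewrite !modn_small //; lia.
have mixed c d : (forall j, (c j <= coord_max p j)%N) -> (forall j, (d j <= coord_max p j)%N) ->
    c 0%N = p -> d 0%N != p ->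
    ((p ^ f)%N %| (from_digits p e c * from_digits p e d)%:Z - 1)%Z <->
     (forall j, (j < f)%N -> c j = d j).
  move=> cmax dmax c0 d0; split=> [|h]; last first.
    have [->|/h] := posnP f; first by rewrite expn0 dvd1z.
    by rewrite c0 => /esym/eqP; rewrite (negPf d0).
  have [->//|f0] := posnP f; rewrite (dvdz_natB _ _ 1) => /eqP h.
  have : (from_digits p e c * from_digits p e d = 1 %[mod p])%N.
    have pf : (p %| p ^ f)%N by apply: dvdn_exp.
    by rewrite -(modn_dvdm _ pf) h modn_dvdm.
  have := from_digits_mod c p0 (leq_trans f0 fe).
  rewrite expn1 => ec; rewrite -modnMml ec /from_digits big_ord1 c0 modnn !mul0n.
  by rewrite mod0n modn_small ?prime_gt1.
rewrite /proj_point; case: eqVneq => [a0|a0]; case: eqVneq => [b0|b0]; rewrite /det /zpair /=.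
- by rewrite mulr1 mul1r dvdz_natB; apply: eqab => //; rewrite a0 b0 eqxx.
- by rewrite mul1r -PoszM; apply: mixed.
- rewrite mul1r -PoszM -rpredN opprB mulnC mixed //.
  by split=> h j jf; rewrite h.
- by rewrite mulr1 mul1r -rpredN opprB dvdz_natB; apply: eqab => //; rewrite (negPf a0) (negPf b0).
Qed.

Lemma solve_mod (x y : int) (m : nat) : (0 < m)%N -> coprimez x m ->
  exists r : nat, (m %| x * r - y)%Z.
Proof.
move=> m0 /coprimezP[[s t] /= e].
exists `|(s * y %% m)%Z|%N.
have -> : `|(s * y %% m)%Z|%N = s * y - (s * y %/ m)%Z * m :> int by lia.
apply/dvdzP; exists (- (t * y) - x * (s * y %/ m)%Z).
apply: subr0_eq; transitivity (y * (s * x + t * m - 1)); first by ring.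
by rewrite e subrr mulr0.
Qed.

(** Scale [v] to [(1 : r)] if [p] does not divide [v.1], and to [(r : 1)] otherwise, then expand [r]
    in base [p]. *)
Lemma exists_proj_point p e v : prime p -> (0 < e)%N -> primitive_mod p v ->
  exists2 a : nat -> nat, forall j, (a j <= coord_max p j)%N &
    ((p ^ e)%N %| det v (zpair (proj_point p e a)))%Z.
Proof.
move=> pp e0 prim; have p0 := prime_gt0 pp.
have pe : (0 < p ^ e)%N by rewrite expn_gt0 p0.
have cop1 (x : int) : ~~ (p %| x)%Z -> coprimez x p.
  by move=> px; rewrite coprimez_sym coprimezE /= prime_coprime.
have cop x : ~~ (p %| x)%Z -> coprimez x (p ^ e)%N.
  by move/cop1; rewrite !coprimezE /=; apply: coprimeXr.
pose digit r j := (r %/ p ^ j %% p)%N.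
have digitP r : from_digits p e (digit r) = (r %% p ^ e)%N.
  rewrite -from_digitsK //; apply/eq_from_digits => // j _; exact: modn_mod.
have digit_max r j : (digit r j < p)%N by apply: ltn_pmod.
have modr r : exists c : int, (r %% p ^ e)%N = r%:Z - c * (p ^ e)%N :> int.
  by exists (r %/ p ^ e)%N; rewrite {2}(divn_eq r (p ^ e)); lia.
case: (boolP (p %| v.1)%Z) => [pv1|/cop/solve_mod-/(_ v.2 pe)[r hr]].
  have npv2 : ~~ (p %| v.2)%Z.
    apply/negP => pv2; move: prim; rewrite /primitive_mod /coprimez.
    have : (p %| gcdz (gcdz v.1 v.2) p)%Z by rewrite !dvdz_gcd pv1 pv2 dvdzz.
    by move=> + /eqP e1; rewrite e1 dvdz1 /=; move: (prime_gt1 pp) => ? /eqP; lia.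
  have /solve_mod-/(_ v.1 pe)[r hr] := cop _ npv2.
  (* The lowest digit of [r] is 0, so the value [p], which selects this chart, can stand in for
     it. *)
  have pr : (p %| r)%N.
    have pv2r : (p %| v.2 * r)%Z.
      rewrite -(subrK v.1 (v.2 * r)) rpredD //; apply: dvdz_trans hr.
      exact: dvdn_exp.
    have cpv : coprimez p v.2 by rewrite coprimez_sym cop1.
    by move: pv2r; rewrite (Gauss_dvdzr _ cpv).
  exists (fun j => if j == 0%N then p else digit r j) => [[|j]|] /=.
  - by rewrite /coord_max /=; lia.
  - by rewrite /coord_max /=; have := digit_max r j.+1; lia.
  - rewrite /proj_point /= eqxx.
    have -> : from_digits p e (fun j => if j == 0%N then p else digit r j) = (r %% p ^ e)%N.
      rewrite -digitP; apply/eq_from_digits => // -[|j] _ //=.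
      by rewrite /digit expn0 divn1 (eqP pr) modnn mod0n.
    have [c ec] := modr r; rewrite /det /zpair /= ec -rpredN.
    have -> : - (v.1 * 1 - v.2 * (r%:Z - c * (p ^ e)%N)) = v.2 * r - v.1 - v.2 * c * (p ^ e)%N by ring.
    by rewrite rpredB // dvdz_mull.
exists (digit r) => [j|].
  by rewrite /coord_max /=; have := digit_max r j; lia.
have := digit_max r 0%N; rewrite ltn_neqAle /proj_point => /andP[/negPf-> _].
rewrite digitP; have [c ec] := modr r; rewrite /det /zpair /= ec.
have -> : v.1 * (r%:Z - c * (p ^ e)%N) - v.2 * 1 = v.1 * r - v.2 - v.1 * c * (p ^ e)%N by ring.
by rewrite rpredB // dvdz_mull.
Qed.

Lemma chinese_seq (s : seq nat) (e r : nat -> nat) :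
  uniq s -> all prime s ->
  exists x, forall p, p \in s -> x = r p %[mod p ^ e p].
Proof.
elim: s => [|q s IHs] /=; first by exists 0%N.
case/andP=> qs us /andP[qp sp]; have [x xP] := IHs us sp.
pose M := (\prod_(p <- s) p ^ e p)%N.
have coM : coprime (q ^ e q) M.
  rewrite /M big_seq; elim/big_ind: _ => [|a b ca cb|p ps]; first exact: coprimen1.
    by rewrite coprimeMr ca.
  apply/coprimeXl/coprimeXr; rewrite prime_coprime // dvdn_prime2 ?(allP sp p ps) //.
  by apply: contraNneq qs => ->.
exists (chinese (q ^ e q) M (r q) x) => p; rewrite inE => /predU1P[->|ps].
  exact: chinese_modl.
have pM : (p ^ e p %| M)%N by rewrite /M (big_rem p) //= dvdn_mulr.
rewrite -(modn_dvdm _ pM) chinese_modr // modn_dvdm // xP //.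
Qed.

Lemma dvdz_det_congr (d : int) (u u' v v' : Z2) :
  (d %| u.1 - u'.1)%Z -> (d %| u.2 - u'.2)%Z ->
  (d %| v.1 - v'.1)%Z -> (d %| v.2 - v'.2)%Z ->
  (d %| det u v)%Z = (d %| det u' v')%Z.
Proof.
move=> u1 u2 v1 v2; rewrite -(subrK (det u' v') (det u v)) rpredDl //.
have -> : det u v - det u' v' = (u.1 - u'.1) * v.2 + u'.1 * (v.2 - v'.2)
    - ((u.2 - u'.2) * v.1 + u'.2 * (v.1 - v'.1)) by rewrite /det; ring.
by rewrite rpredB //; apply: rpredD; by [apply: dvdz_mulr|apply: dvdz_mull].
Qed.

Lemma exists_logn_lt n D : (0 < n)%N -> (0 < D)%N -> ~~ (n %| D)%N ->
  exists p, (logn p D < logn p n)%N.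
Proof.
move=> n0 D0 nD; apply: contrapT => no; move/negP: nD; apply.
apply/dvdn_partP => // p; rewrite mem_primes => /and3P[pp _ _].
rewrite p_part pfactor_dvdn // leqNgt; apply/negP => lt.
by apply: no; exists p.
Qed.

(** * Gluing the coordinates at the primes dividing [N] *)

Section ProjectiveLine.
Variables (N : nat) (N0 : (0 < N)%N).

(** The pair [(p, j)] stands for level [j] at [p]. Pairs with [p] not prime or [j >= logn p N] also
    occur; no lattice of index dividing [N] fixes them. *)
Let I := ('I_N.+1 * 'I_N.+1)%type.

Definition coord_bound (i : I) : nat := coord_max i.1 i.2.

Let coord (x : I -> nat) (p j : nat) : nat :=
  if (j <= N)%N then x (inord p, inord j) else 0%N.

Let coord_le x p j : in_box coord_bound x -> (p <= N)%N ->
  (coord x p j <= coord_max p j)%N.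
Proof.
move=> xb pN; rewrite /coord; case: (leqP j N) => // jN.
by have := xb (inord p, inord j); rewrite /coord_bound /= !inordK ?ltnS.
Qed.

Let primes_le p : p \in primes N -> (p <= N)%N.
Proof. by rewrite mem_primes => /and3P[_ _]; apply: dvdn_leq. Qed.

Lemma exists_lift (x : I -> nat) : exists v : Z2, forall p, p \in primes N ->
  (((p ^ logn p N)%N %| v.1 - (zpair (proj_point p (logn p N) (coord x p))).1)%Z /\
   ((p ^ logn p N)%N %| v.2 - (zpair (proj_point p (logn p N) (coord x p))).2)%Z).
Proof.
have up := primes_uniq N; have ap := all_prime_primes N.
have [v1 v1P] := chinese_seq (logn^~ N) (fun p => (proj_point p (logn p N) (coord x p)).1) up ap.
have [v2 v2P] := chinese_seq (logn^~ N) (fun p => (proj_point p (logn p N) (coord x p)).2) up ap.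
exists (v1%:Z, v2%:Z) => p pN.
by rewrite !dvdz_natB /= v1P // v2P.
Qed.

Definition lift_coords (x : I -> nat) : Z2 := projT1 (cid (exists_lift x)).

Let liftP x p : p \in primes N ->
  (((p ^ logn p N)%N %| (lift_coords x).1 - (zpair (proj_point p (logn p N) (coord x p))).1)%Z /\
   ((p ^ logn p N)%N %| (lift_coords x).2 - (zpair (proj_point p (logn p N) (coord x p))).2)%Z).
Proof. exact: projT2 (cid (exists_lift x)) p. Qed.

(** A prime dividing [N] and both entries of the lift would divide both entries of a projective
    point, one of which is 1. *)
Lemma lift_coords_primitive x : primitive_mod N (lift_coords x).
Proof.
rewrite /primitive_mod coprimezE /= /coprime.
set g := gcdn _ _; apply/negPn/negP => g1.
have pp : prime (pdiv g).
  by apply: pdiv_prime; rewrite ltn_neqAle eq_sym g1 gcdn_gt0 N0 orbT.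
have := pdiv_dvd g; move: (pdiv g) pp => p pp; rewrite !dvdn_gcd.
case/andP=> /andP[p1 p2] pN.
have pNp : p \in primes N by rewrite mem_primes pp N0.
have e0 : (0 < logn p N)%N by rewrite logn_gt0.
have [] := liftP x pNp.
have pe (a b : int) : (p %| a)%Z -> ((p ^ logn p N)%N %| a - b)%Z -> (p %| b)%Z.
  move=> pa h; rewrite -(rpredBl _ pa); apply: dvdz_trans h.
  exact: dvdn_exp.
move=> /(pe _ _ p1) q1 /(pe _ _ p2) q2.
have : (p %| 1)%Z by move: q1 q2; rewrite /zpair /proj_point; case: ifP.
by rewrite dvdz1 /= => /eqP e; rewrite e in pp.
Qed.

(** Divisibility by [d] is tested at each prime power of [d], where the lifts are congruent to the
    local projective points. *)
Lemma dvdz_det_lift d x y :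
  in_box coord_bound x -> in_box coord_bound y -> (d %| N)%N ->
  (d %| det (lift_coords x) (lift_coords y))%Z <->
  forall i : I, (i.2 < logn i.1 d)%N -> x i = y i.
Proof.
move=> xb yb dN; have d0 := dvdn_gt0 N0 dN.
have localP p : p \in primes d ->
    ((p ^ logn p d)%N %| det (lift_coords x) (lift_coords y))%Z <->
    forall j, (j < logn p d)%N -> coord x p j = coord y p j.
  move=> pd; have pp : prime p by move: pd; rewrite mem_primes => /andP[].
  have pN : p \in primes N.
    by move: pd; rewrite !mem_primes N0 => /and3P[-> _ /dvdn_trans->].
  have le : (logn p d <= logn p N)%N by apply: dvdn_leq_log.
  have ple := primes_le pN.
  rewrite -(dvdz_det_proj_point pp le (fun j => coord_le j xb ple) (fun j => coord_le j yb ple)).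
  have [x1 x2] := liftP x pN; have [y1 y2] := liftP y pN.
  have tr (z : int) : ((p ^ logn p N)%N %| z)%Z -> ((p ^ logn p d)%N %| z)%Z.
    by apply: dvdz_trans; apply: dvdn_exp2l.
  by rewrite (dvdz_det_congr (tr _ x1) (tr _ x2) (tr _ y1) (tr _ y2)).
have dE : (d %| det (lift_coords x) (lift_coords y))%Z <->
    forall p, p \in primes d -> ((p ^ logn p d)%N %| det (lift_coords x) (lift_coords y))%Z.
  split=> [h p _|h]; first by apply: dvdz_trans h; apply: pfactor_dvdnn.
  by apply/dvdn_partP => // p pd; rewrite p_part; apply: h.
rewrite dE; split=> [h [p j] /= jp|h p pd].
  have pd : (p : nat) \in primes d by rewrite -logn_gt0 (leq_ltn_trans (leq0n _) jp).
  have := (localP p pd).1 (h p pd) j jp.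
  by rewrite /coord -ltnS ltn_ord !inord_val.
apply/localP => // j jp; rewrite /coord; case: (leqP j N) => // jN; apply: h => /=.
rewrite !inordK ?ltnS //; apply: primes_le.
by move: pd; rewrite !mem_primes N0 => /and3P[-> _ /dvdn_trans->].
Qed.

Lemma exists_coords v : primitive_mod N v ->
  exists2 x, in_box coord_bound x & (N %| det v (lift_coords x))%Z.
Proof.
move=> prim.
have /choice[a aP] : forall p, exists a, p \in primes N ->
    (forall j, (a j <= coord_max p j)%N) /\
    ((p ^ logn p N)%N %| det v (zpair (proj_point p (logn p N) a)))%Z.
  move=> p; case: (boolP (p \in primes N)) => pN; last by exists id.
  have := pN; rewrite mem_primes => /and3P[pp _ pdN].
  have e0 : (0 < logn p N)%N by rewrite logn_gt0.
  have [|a a1 a2] := @exists_proj_point p _ v pp e0; last by exists a.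
  exact: coprimez_dvdr prim.
pose x (i : I) := if (i.1 : nat) \in primes N then a i.1 i.2 else 0%N.
have xb : in_box coord_bound x.
  by move=> i; rewrite /x; case: ifP => // /aP[].
exists x => //; apply/dvdn_partP => // p pN; rewrite p_part; have {}pN : p \in primes N := pN.
change ((p ^ logn p N)%N %| det v (lift_coords x))%Z.
have [x1 x2] := liftP x pN; have [_ ] := aP p pN.
have -> : proj_point p (logn p N) (a p) = proj_point p (logn p N) (coord x p).
  have aE j : (j <= N)%N -> a p j = coord x p j.
    by move=> jN; rewrite /coord jN /x /= inordK ?ltnS ?primes_le // pN inordK.
  rewrite /proj_point aE //; congr (if _ then (_, _) else (_, _));
    apply: eq_bigr => j _; rewrite aE //;
    by rewrite (leq_trans (ltnW (ltn_ord j))) // ltnW // ltn_logl.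
by rewrite (dvdz_det_congr (u' := v) _ _ x1 x2) ?subrr ?dvdz0.
Qed.

(** If [a] are the coordinates of [u], the lift of [a] also lies in [L] by the determinant
    criterion. Applied to this lift, the same criterion describes [L] as a subcube. *)
Lemma lattice_coords L u : is_lattice L -> (lattice_index L %| N)%N ->
  L u -> primitive_mod N u ->
  exists a : I -> nat, forall y, in_box coord_bound y ->
    L (lift_coords y) <->
    forall i : I, (i.2 < logn i.1 (lattice_index L))%N -> y i = a i.
Proof.
move=> [subL finL] nN Lu prim; have [a ab aN] := exists_coords prim.
have primL w : primitive_mod N w -> primitive_mod (lattice_index L) w.
  exact: coprimez_dvdr.
have La : L (lift_coords a).
  by apply/(lattice_detP subL finL _ Lu (primL _ prim)); apply: dvdz_trans aN.
exists a => y yb.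
rewrite (lattice_detP subL finL _ La (primL _ (lift_coords_primitive a))).
by rewrite dvdz_det_lift //; split=> h i /h.
Qed.

End ProjectiveLine.

(** * Coverings of Z^2 *)

(** Every vector is a multiple of one with coprime entries, 0 being a multiple of [(1, 0)], and
    subgroups are closed under multiples. *)
Lemma covering_of_primitive N (C : {fset set Z2}) :
  (forall L, L \in C -> is_lattice L) ->
  (forall v, primitive_mod N v -> exists2 L, L \in C & L v) -> is_covering C.
Proof.
move=> latC cov; split=> //; apply/seteqP; split=> // v _.
pose g := gcdz v.1 v.2.
have [w pw [c ->]] : exists2 w, primitive_mod N w & exists c : int, v = w *~ c.
  have [g0|g0] := eqVneq g 0.
    exists (1, 0); first by rewrite /primitive_mod gcd1z coprimezE coprime1n.
    exists 0; move/eqP: g0; rewrite mulr0z gcdz_eq0 => /andP[/eqP v1 /eqP v2].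
    by rewrite [v]surjective_pairing v1 v2.
  exists ((v.1 %/ g)%Z, (v.2 %/ g)%Z); last first.
    exists g; rewrite pair_mulrz /= ![g * _]mulrC.
    by rewrite !divzK ?dvdz_gcdl ?dvdz_gcdr // -surjective_pairing.
  rewrite /primitive_mod /=.
  have -> : gcdz (v.1 %/ g)%Z (v.2 %/ g)%Z = 1.
    apply: (mulfI g0).
    have gE : `|g|%:Z = g by rewrite /g /gcdz absz_nat.
    rewrite mulr1 -[X in X * _]gE mulz_gcdr.
    by rewrite ![g * _]mulrC !divzK ?dvdz_gcdl ?dvdz_gcdr.
  by rewrite coprimezE coprime1n.
have [L LC Lw] := cov w pw.
by exists L => //; apply: subgroupMz => //; case: (latC L LC).
Qed.

(** A common range for [p] lets [G N] and [G D] be compared term by term; values of [p] that are not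
    prime divisors contribute 0. *)
Lemma G_sum N M : (N <= M)%N ->
  G N = (\sum_(p < M.+1) (logn p N * p.-1 + (0 < logn p N)))%N.
Proof.
move=> NM; rewrite -(big_mkord xpredT (fun p => logn p N * p.-1 + (0 < logn p N))%N).
rewrite (bigID (mem (primes N))) /= [X in (_ + X)%N]big1 ?addn0; last first.
  by move=> p; rewrite -logn_gt0 -eqn0Ngt => /eqP ->.
have -> : (\sum_(0 <= p < M.+1 | p \in primes N) (logn p N * p.-1 + (0 < logn p N)) =
    \sum_(0 <= p < M.+1 | p \in primes N) (logn p N * p.-1 + 1))%N.
  by apply: eq_bigr => p; rewrite -logn_gt0 => ->.
rewrite /G -[RHS]big_filter.
apply/perm_big/uniq_perm; rewrite ?primes_uniq ?filter_uniq ?iota_uniq // => p.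
rewrite mem_filter mem_index_iota /=; case: (boolP (p \in _)) => //=.
rewrite mem_primes => /and3P[_ N0 /dvdn_leq]; rewrite ltnS => /(_ N0) pN.
by rewrite (leq_trans pN).
Qed.

(** Each level contributes [p.-1], and level 0 one more: the summand 1 that [G] attaches to a
    prime. *)
Lemma sum_coord_max p d e : (d <= e)%N ->
  (\sum_(d <= j < e) coord_max p j + (d * p.-1 + (0 < d)) = e * p.-1 + (0 < e))%N.
Proof.
elim: e => [|e IHe]; first by rewrite leqn0 => /eqP ->; rewrite big_geq.
case: (ltngtP d e.+1) => // [de _|-> _]; last by rewrite big_geq.
rewrite big_nat_recr //= addnAC IHe // /coord_max mulSn.
by case: (e) => //=; lia.
Qed.

Lemma sum_coord_bound N D : (0 < N)%N -> (D %| N)%N ->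
  (\sum_(i : 'I_N.+1 * 'I_N.+1 | logn i.1 D <= i.2 < logn i.1 N) coord_bound i
    + G D = G N)%N.
Proof.
move=> N0 DN; rewrite (G_sum (leqnn N)) (G_sum (dvdn_leq N0 DN)).
rewrite -(pair_big_dep xpredT (fun p j : 'I_N.+1 => logn p D <= j < logn p N)%N
  (fun p j => coord_max p j)) /= -big_split /=.
apply: eq_bigr => p _; have de : (logn p D <= logn p N)%N by apply: dvdn_leq_log.
rewrite -(sum_coord_max p de); congr (_ + _)%N.
have eN : (logn p N <= N.+1)%N by rewrite ltnW // ltnS ltnW // ltn_logl.
by rewrite (big_nat_widen _ _ _ _ _ eN) big_geq_mkord; apply: eq_bigl => j; rewrite andbC.
Qed.

Lemma logn_lcm_cov (C : {fset set Z2}) p j :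
  (forall L, L \in C -> 0 < lattice_index L)%N ->
  (j < logn p (lcm_cov C))%N -> exists2 L, L \in C & (j < logn p (lattice_index L))%N.
Proof.
move=> C0 lt; apply: contrapT => no; move: lt; apply/negP; rewrite -leqNgt.
suff [] : (0 < lcm_cov C)%N /\ (logn p (lcm_cov C) <= j)%N by [].
rewrite /lcm_cov big_seq; elim/big_ind: _ => [|m n [m0 mj] [n0 nj]|L LC].
- by rewrite logn1.
- by rewrite lcmn_gt0 m0 logn_lcm // geq_max mj nj.
- by split; [apply: C0|rewrite leqNgt; apply/negP => lt; apply: no; exists L].
Qed.

Lemma dvdn_lcm_cov (C : {fset set Z2}) L :
  L \in C -> (lattice_index L %| lcm_cov C)%N.
Proof.
by move=> LC; rewrite /lcm_cov (big_fsetD1 L) //= dvdn_lcml.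
Qed.

Lemma lcm_cov_gt0 (C : {fset set Z2}) :
  (forall L, L \in C -> is_lattice L) -> (0 < lcm_cov C)%N.
Proof.
move=> latC; rewrite /lcm_cov big_seq; elim/big_ind: _ => // [m n m0 n0|L LC].
  by rewrite lcmn_gt0 m0.
by case: (latC L LC) => subL finL; apply: lattice_index_gt0.
Qed.

(** Otherwise the other members would contain all primitive vectors and so form a covering. *)
Lemma irredundant_primitive (C : {fset set Z2}) N L :
  irredundant_covering C -> L \in C -> exists2 u, L u & primitive_mod N u.
Proof.
move=> [[latC covC] irrC] LC; apply: contrapT => no.
apply: (irrC (C `\ L)%fset); first exact: fproperD1.
apply: (@covering_of_primitive N) => [M|v prim].
  by rewrite in_fsetD1 => /andP[_ /latC].
have [M /= MC Mv] : (\bigcup_(L in [set` C]) L) v by rewrite covC.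
exists M => //; rewrite in_fsetD1 MC andbT; apply/eqP => ML.
by apply: no; exists v; rewrite // -ML.
Qed.

(** Having [G D] on the right avoids truncated subtraction. *)
Lemma irredundant_covering_bound (C : {fset set Z2}) D :
  irredundant_covering C -> (0 < D)%N -> (D %| lcm_cov C)%N -> D <> lcm_cov C ->
  (G (lcm_cov C) < #|` [fset L in C | ~~ (lattice_index L %| D)%N]| + G D)%N.
Proof.
move=> hC D0 DN neq; have [[latC covC] irrC] := hC.
have N0 := lcm_cov_gt0 latC; set N := lcm_cov C in DN neq N0 *.
pose I := ('I_N.+1 * 'I_N.+1)%type; pose K : finType := C.
have latK (k : K) : is_lattice (val k) by apply: latC; apply: valP.
have indexK (k : K) : (lattice_index (val k) %| N)%N by apply/dvdn_lcm_cov/valP.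
have indexK0 (k : K) : (0 < lattice_index (val k))%N by apply: dvdn_gt0 (indexK k).
pose V := @lift_coords N.
have /choice[a aP] (k : K) : exists a : I -> nat, forall y, in_box (@coord_bound N) y ->
    val k (V y) <-> forall i : I, (i.2 < logn i.1 (lattice_index (val k)))%N -> y i = a i.
  have [u ku prim] := irredundant_primitive N hC (valP k).
  exact: (lattice_coords N0 (latK k) (indexK k) ku prim).
pose m (k : K) := finset (fun i : I => i.2 < logn i.1 (lattice_index (val k)))%N.
have cellP k y : in_box (@coord_bound N) y -> val k (V y) <-> in_cell m a k y.
  by move=> yb; rewrite aP //; split=> h i; have := h i; rewrite inE.
(* A subfamily covering the box contains every primitive vector, as such a vector is proportional
   modulo [N] to a lift. It is then a covering, so irredundancy makes it the whole family. *)
have minK : mincover (@coord_bound N) m a [set: I]%SET (fun=> 0%N) [set: K]%SET.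
  apply/mincoverP; split=> [y yb _|F covF _].
    have [L /= LC Ly] : (\bigcup_(L in [set` C]) L) (V y) by rewrite covC.
    by exists [` LC]; [rewrite inE|apply/cellP].
  apply/setP => k; rewrite inE; apply: contrapT => /negP kF.
  apply: (irrC [fset val k' | k' in F]).
    rewrite fproperE; apply/andP; split.
      by apply/fsubsetP => _ /imfsetP[k' _ ->]; apply: valP.
    apply/negP => /fsubsetP/(_ _ (valP k)); apply/negP.
    apply/imfsetP => -[k' /= k'F] /val_inj kk'.
    by rewrite kk' k'F in kF.
  apply: (@covering_of_primitive N) => [_ /imfsetP[k' _ ->]|v prim]; first exact: latK.
  have [y yb vy] := exists_coords N0 prim.
  have [|k' k'F /cellP k'y] := covF y yb; first by move=> i; rewrite !inE.
  exists (val k'); first by apply/imfsetP; exists k'.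
  have [subL finL] := latK k'.
  apply/(lattice_detP subL finL v (k'y yb)).
    by apply: coprimez_dvdr (indexK k') _; apply: lift_coords_primitive.
  have -> : det (V y) v = - det v (V y) by rewrite /det; ring.
  by rewrite rpredN; apply: dvdz_trans vy; apply: indexK.
pose S := finset (fun i : I => logn i.1 D <= i.2 < logn i.1 N)%N.
have S0 : S != finset.set0.
  have [|p lt] := @exists_logn_lt N D N0 D0.
    by apply/negP => ND; apply: neq; apply/eqP; rewrite eqn_dvd DN.
  have pN : (p < N.+1)%N.
    have := leq_ltn_trans (leq0n _) lt; rewrite logn_gt0 mem_primes.
    by case/and3P=> _ _ /(dvdn_leq N0).
  have dN : (logn p D < N.+1)%N by apply: ltn_trans lt (ltn_trans (ltn_logl p N0) _).
  by apply/set0Pn; exists (Ordinal pN, Ordinal dN); rewrite inE leqnn.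
have Sused : S \subset (\bigcup_(k in [set: K]%SET) m k)%SET.
  apply/fintype.subsetP => i; rewrite inE => /andP[_].
  have C0 L : L \in C -> (0 < lattice_index L)%N by move=> LC; apply: (indexK0 [` LC]).
  case/(logn_lcm_cov C0) => L LC lt.
  by apply/finset.bigcupP; exists [` LC]; rewrite !inE.
have := mincover_bound _ minK (finset.subsetT S) S0 Sused.
rewrite -(sum_coord_bound N0 DN) ltn_add2r => bound.
rewrite (eq_bigl (fun i => i \in S)) => [|i]; last by rewrite inE.
apply: leq_trans (bound _) _ => //.
have cardA (A : {set K}) : #|` [fset val k | k in [fset x in A]]%fset| = #|A|.
  by rewrite -card_finset; apply: (card_imfset _ _ val_inj).
rewrite -cardA.
apply/fsubset_leq_card/fsubsetP => _ /imfsetP[k /= + ->].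
(* A subcube fixing a coordinate [(p, j)] of [S] has index [n] with [logn p D <= j < logn p n], so
   [n] cannot divide [D]. *)
rewrite in_fset => /meetingP[_ [i]]; rewrite !inE => ik /andP[di _].
rewrite (valP k) /=; apply/negP => nD.
have := dvdn_leq_log i.1 D0 nD; rewrite leqNgt => /negP; apply.
exact: leq_ltn_trans di ik.
Qed.

Lemma lattice_index1 L : is_lattice L -> lattice_index L = 1%N -> L = [set: Z2].
Proof.
move=> [subL finL] e; apply/seteqP; split=> // v _.
by rewrite -[v]mulr1n -e; apply: lattice_index_mul.
Qed.

Theorem theorem6p8 (C : {fset set Z2}) (hC : irredundant_covering C) :
  (forall D : nat, (0 < D)%N -> (D %| lcm_cov C)%N -> D <> lcm_cov C ->
     1 + (G (lcm_cov C))%:Z - (G D)%:Z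
       <= #|` [fset L in C | ~~ (lattice_index L %| D)%N] |%:Z)
  /\
  (C <> [fset [set: Z2]]%fset ->
     (1 < lcm_cov C)%N /\ (1 + G (lcm_cov C) <= #|` C|)%N).
Proof.
split=> [D D0 DN neq|nontriv].
  have := irredundant_covering_bound hC D0 DN neq; lia.
have [[latC covC] _] := hC.
have N1 : (1 < lcm_cov C)%N.
  rewrite ltn_neqAle lcm_cov_gt0 // andbT eq_sym; apply/eqP => N1; apply: nontriv.
  have LT L : L \in C -> L = [set: Z2].
    move=> LC; apply: lattice_index1; first exact: latC.
    by apply/eqP; rewrite -dvdn1 -N1 dvdn_lcm_cov.
  have [L /= LC _] : (\bigcup_(L in [set` C]) L) 0 by rewrite covC.
  apply/fsetP => M; rewrite inE; apply/idP/eqP => [/LT//|->].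
  by rewrite -(LT L LC).
split=> //; have neq : 1%N <> lcm_cov C by move=> e; rewrite -e in N1.
have := @irredundant_covering_bound C 1 hC isT (dvd1n _) neq.
have -> : G 1 = 0%N by rewrite /G big_nil.
rewrite addn0 add1n => /leq_trans; apply.
by apply/fsubset_leq_card/fsubsetP => L; rewrite !inE => /andP[].
Qed.
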